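(* For every integer $n\geq 1$, the polynomial $\tilde A_n(x,y|\alpha)$ has an expansion $$\tilde A_n(x,y|\alpha)=\sum_{k=0}^{\lfloor n/2\rfloor}\tilde{\gamma}_{n,k}(\alpha)\,(xy)^{k}(x+y)^{n-2k},$$ where for each $0\le k\le \lfloor n/2\rfloor$, $$\tilde{\gamma}_{n,k}(\alpha)=\sum_{\sigma \in \Gamma^{(1)}_{n,k}}\alpha^{\mathrm{LRmin}(\sigma)+\mathrm{RLmin}(\sigma)-2} =2^{-n+2k}\sum_{\sigma \in \Gamma^{(2)}_{n,k}}\alpha^{\mathrm{LRmin}(\sigma)+\mathrm{RLmin}(\sigma)-2} =\sum_{\sigma \in \Gamma^{(3)}_{n,k}}\alpha^{\mathrm{RLmin}(\sigma)}.$$ Here: (1) $\Gamma^{(1)}_{n,k}$ is the set of permutations in $\mathrm{PRW}_{n+1}$ with $k$ ascents and no double ascents; (2) $\Gamma^{(2)}_{n,k}$ is the set of permutations in $\mathrm{PRW}_{n+1}$ with $k$ peaks; (3) $\Gamma^{(3)}_{n,k}$ is the set of permutations $\sigma=\sigma_1\cdots\sigma_n\in\mathfrak{S}_n$ with $k$ descents for which there is no index $1<i<n$ with $\sigma_{i-1}>\sigma_i>\sigma_{i+1}$.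
   Context: $\mathfrak{S}_n$ is the set of permutations $\sigma=\sigma_1\cdots\sigma_n$ of $[n]=\{1,\dots,n\}$. An index $i\in[n-1]$ is a descent (resp. ascent) of $\sigma$ if $\sigma_i>\sigma_{i+1}$ (resp. $\sigma_i<\sigma_{i+1}$); $\mathrm{des}(\sigma)$ and $\mathrm{asc}(\sigma)$ are the numbers of descents and ascents. $\mathrm{PRW}_n$ is the set of $\pi\in\mathfrak{S}_n$ such that the first ascent (if any) of $\pi$ appears at the letter $1$; i.e., if $\pi$ has an ascent and $i$ is the smallest one, then $\pi_i=1$. A left-to-right minimum (resp. right-to-left minimum) of $\sigma\in\mathfrak{S}_n$ is a letter $\sigma_i$ such that $\sigma_j>\sigma_i$ for every $j<i$ (resp. every $j>i$); $\mathrm{LRmin}(\sigma)$ and $\mathrm{RLmin}(\sigma)$ are the numbers of these. With the convention $\sigma_0=\sigma_{n+1}=+\infty$ for $\sigma\in\mathfrak{S}_n$, a value $\sigma_i$ ($1\le i\le n$) is a double ascent if $\sigma_{i-1}<\sigma_i<\sigma_{i+1}$, and a peak if $\sigma_{i-1}<\sigma_i>\sigma_{i+1}$. The binomial-Stirling-Eulerian polynomials are $$\tilde{A}_n(x,y|\alpha)=\sum_{\sigma\in\mathrm{PRW}_{n+1}}x^{\mathrm{des}(\sigma)}y^{\mathrm{asc}(\sigma)}\alpha^{\mathrm{LRmin}(\sigma)+\mathrm{RLmin}(\sigma)-2}.$$ *)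

(* Defs.v *)
(* Mathematical Components world. *)
From HB Require Import structures.
From mathcomp Require Import all_boot all_order all_fingroup all_algebra.
From mathcomp Require Import mpoly.

Set Implicit Arguments.
Unset Strict Implicit.
Unset Printing Implicit Defensive.

Import GRing.Theory.

(* 'S_n permutes {0, ..., n-1}; [letter s i] is the letter sigma_i in
   {1, ..., n} at the 1-based position 1 <= i <= n.  Elsewhere (in particular
   at i = 0 and i = n.+1) it is n.+1, which exceeds every letter and encodes
   the convention sigma_0 = sigma_{n+1} = +oo. *)
Definition letter (n : nat) (s : 'S_n) (i : nat) : nat :=
  if i is j.+1 then
    if insub j is Some j' then (s (j' : 'I_n)).+1 else n.+1
  else n.+1.

Definition descent (n : nat) (s : 'S_n) (i : nat) : bool :=
  (1 <= i < n) && (letter s i > letter s i.+1).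

Definition ascent (n : nat) (s : 'S_n) (i : nat) : bool :=
  (1 <= i < n) && (letter s i < letter s i.+1).

Definition des (n : nat) (s : 'S_n) : nat := #|[set i : 'I_n | descent s i]|.

Definition asc (n : nat) (s : 'S_n) : nat := #|[set i : 'I_n | ascent s i]|.

Definition first_ascent (n : nat) (s : 'S_n) (i : nat) : bool :=
  ascent s i && [forall j : 'I_n, (j < i) ==> ~~ ascent s j].

Definition PRW (n : nat) : {set 'S_n} :=
  [set s : 'S_n | [forall i : 'I_n, first_ascent s i ==> (letter s i == 1)]].

Definition LRmin (n : nat) (s : 'S_n) : nat :=
  #|[set i : 'I_n | [forall j : 'I_n, (j < i) ==> (s i < s j)]]|.

Definition RLmin (n : nat) (s : 'S_n) : nat :=
  #|[set i : 'I_n | [forall j : 'I_n, (i < j) ==> (s i < s j)]]|.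

Definition double_ascent (n : nat) (s : 'S_n) (i : nat) : bool :=
  (letter s i.-1 < letter s i) && (letter s i < letter s i.+1).

Definition peak (n : nat) (s : 'S_n) (i : nat) : bool :=
  (letter s i.-1 < letter s i) && (letter s i > letter s i.+1).

Definition peaks (n : nat) (s : 'S_n) : nat :=
  #|[set i : 'I_n | peak s i.+1]|.

Definition Gamma1 (n k : nat) : {set 'S_n.+1} :=
  [set s in PRW n.+1 |
     (asc s == k) && [forall i : 'I_n.+1, ~~ double_ascent s i.+1]].

Definition Gamma2 (n k : nat) : {set 'S_n.+1} :=
  [set s in PRW n.+1 | peaks s == k].

Definition Gamma3 (n k : nat) : {set 'S_n} :=
  [set s : 'S_n | (des s == k) &&
     [forall i : 'I_n, ~~ [&& 1 < i, letter s i.-1 > letter s i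
                            & letter s i > letter s i.+1]]].

Local Open Scope ring_scope.

(* Q[x, y, alpha] is represented as Q[alpha][x, y]. *)
Definition alpha : {poly rat} := 'X.
Definition x : {mpoly {poly rat}[2]} := 'X_ord0.
Definition y : {mpoly {poly rat}[2]} := 'X_ord_max.

(* The truncated subtraction is harmless: the letter 1 is both a left-to-right
   and a right-to-left minimum. *)
Definition tildeA (n : nat) : {mpoly {poly rat}[2]} :=
  \sum_(s in PRW n.+1)
     alpha ^+ (LRmin s + RLmin s - 2)%N *: (x ^+ des s * y ^+ asc s).

(* Main.v *)
(* Every permutation in PRW_{n+1} is a word L 1 R with L decreasing.  Give it
   the weight u^|L| a^{RLmin(R)} times a letter x, y, p, 1 for every double
   descent, double ascent, peak, valley of R (bordered by 1 and +oo).  Putting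
   the new largest letter in front multiplies the weight by u, putting it at
   the end multiplies it by a y, and putting it elsewhere to the right of 1
   differentiates the weight: x -> p, y -> p, p -> p (x + y).  So the total
   weight is (c + D)^n 1 with c = u + a y and D this derivation, and it is
   determined by the D^j c.  For u = a x these are a (x + y) and, for j > 0,
   polynomials in a, x + y and p: the total weight depends on x and y only
   through x + y.  The point (x, y, p) = (x, y, xy) gives the polynomial A_n,
   (s, 0, p) gives Gamma^(1), and (s/2, s/2, p) gives Gamma^(2).  For
   Gamma^(3) the words R = sigma of S_n, bordered by 0 and +oo, satisfy the
   same recurrence with u = 0, taken at (0, s, p). *)
Require Import Defs.
From mathcomp Require Import all_boot all_order all_fingroup all_algebra.
From mathcomp Require Import mpoly ring zify.
Import GRing.Theory.

Local Open Scope ring_scope.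

(** * Growth sequences of a derivation *)

Record derivation (K : comNzRingType) (D : K -> K) : Prop := Derivation {
  derD : forall f g, D (f + g) = D f + D g;
  derM : forall f g, D (f * g) = D f * g + f * D g }.
Arguments derD {K D}.
Arguments derM {K D}.

Lemma der0 (K : comNzRingType) (D : K -> K) : derivation K D -> D 0 = 0.
Proof. by move=> dD; apply: (@addrI _ (D 0)); rewrite -derD // !addr0. Qed.

Lemma der1 (K : comNzRingType) (D : K -> K) : derivation K D -> D 1 = 0.
Proof.
move=> dD; apply: (@addrI _ (D 1)); rewrite addr0.
by rewrite -{3}[1]mulr1 derM // mulr1 mul1r.
Qed.

Lemma der_const (K : comNzRingType) (D : K -> K) a f k :
  derivation K D -> D a = 0 -> D (a ^+ k * f) = a ^+ k * D f.
Proof.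
move=> dD Da; elim: k => [|k IHk]; first by rewrite !mul1r.
by rewrite !exprS -!mulrA derM // Da mul0r add0r IHk.
Qed.

Lemma derMn (K : comNzRingType) (D : K -> K) f n :
  derivation K D -> D (f *+ n) = D f *+ n.
Proof.
move=> dD; elim: n => [|n IHn]; first by rewrite !mulr0n der0.
by rewrite !mulrS derD // IHn.
Qed.

Lemma der_sum (K : comNzRingType) (D : K -> K) (I : Type) (r : seq I) (F : I -> K) :
  derivation K D -> D (\sum_(i <- r) F i) = \sum_(i <- r) D (F i).
Proof.
move=> dD; elim: r => [|i r IHr]; first by rewrite !big_nil der0.
by rewrite !big_cons derD // IHr.
Qed.

Definition growth (K : comNzRingType) (D : K -> K) (c : K) (n : nat) : K :=
  iter n (fun f => c * f + D f) 1.

(* Applying [c + D] to the right-hand side moves one derivative to either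
   factor, so the induction is Pascal's rule. *)
Lemma growthS (K : comNzRingType) (D : K -> K) (c : K) n :
  derivation K D ->
  growth K D c n.+1 =
    \sum_(0 <= j < n.+1) (iter j D c * growth K D c (n - j)) *+ 'C(n, j).
Proof.
move=> dD; elim: n => [|n IHn].
  by rewrite big_nat1 /growth /= (der1 _ _ dD) addr0 bin0.
rewrite [LHS]/growth iterS -/(growth K D c n.+1) IHn.
rewrite mulr_sumr (der_sum _ _ _ _ _ dD) -big_split /=.
rewrite (eq_bigr (fun j => (iter j.+1 D c * growth K D c (n - j)) *+ 'C(n, j) +
   (iter j D c * growth K D c (n - j).+1) *+ 'C(n, j))); last first.
  move=> j _; rewrite (derMn _ _ _ _ dD) (derM dD) mulrnAr -!mulrnDl.
  congr (_ *+ _); rewrite [growth K D c (n - j).+1]/growth iterS -/(growth K D c (n - j)).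
  by rewrite /= mulrDr addrCA mulrCA.
rewrite big_split /=.
rewrite [RHS]big_nat_recl // [in RHS]bin0 subn0.
rewrite [in RHS](eq_bigr (fun j => (iter j.+1 D c * growth K D c (n - j)) *+ 'C(n, j) +
  (iter j.+1 D c * growth K D c (n - j)) *+ 'C(n, j.+1))); last first.
  by move=> j _; rewrite subSS binS mulrnDr addrC.
rewrite [in RHS]big_split /= [RHS]addrCA; congr (_ + _).
rewrite [LHS]big_nat_recl // bin0 subn0; congr (_ + _).
rewrite [RHS]big_nat_recr //= bin_small // mulr0n addr0.
by rewrite big_nat [RHS]big_nat; apply: eq_bigr => j /andP[_ ltjn]; rewrite -(subnSK ltjn).
Qed.

(** By [growthS] the sequence is built from the iterates [D^j c] by sums and products alone, so a
    morphism sees only their images. Neither [phi] nor [psi] has to commute with [D]. *)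
Lemma growth_transfer (K A : comNzRingType) (D : K -> K)
    (phi psi : {rmorphism K -> A}) (c d : K) n :
  derivation K D -> (forall j, phi (iter j D c) = psi (iter j D d)) ->
  phi (growth K D c n) = psi (growth K D d n).
Proof.
move=> dD eqcd; elim/ltn_ind: n => [[|n] IHn]; first by rewrite !rmorph1.
rewrite !growthS // !rmorph_sum; apply: eq_big_nat => j /andP[_ ltjn].
by rewrite !rmorphMn !rmorphM eqcd IHn // ltnS leq_subr.
Qed.

(** The subsemiring without unit generated by [s] and [p]; a ring morphism is determined on it by
    its values at these two elements. *)
Inductive generated (K : comNzRingType) (s p : K) : K -> Prop :=
| gen_s : generated K s p s
| gen_p : generated K s p p
| gen_add f g : generated K s p f -> generated K s p g -> generated K s p (f + g)
| gen_mul f g : generated K s p f -> generated K s p g -> generated K s p (f * g).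

Lemma generated_der (K : comNzRingType) (D : K -> K) s p f :
  derivation K D -> generated K s p (D s) -> generated K s p (D p) ->
  generated K s p f -> generated K s p (D f).
Proof.
move=> dD Ds Dp; elim=> // g h genf IHf geng IHg.
  by rewrite derD //; apply: gen_add.
by rewrite derM //; apply: gen_add; apply: gen_mul.
Qed.

Lemma generated_eq (K A : comNzRingType) (phi psi : {rmorphism K -> A}) s p f :
  phi s = psi s -> phi p = psi p -> generated K s p f -> phi f = psi f.
Proof.
move=> eqs eqp; elim=> // g h _ IHg _ IHh.
  by rewrite !rmorphD IHg IHh.
by rewrite !rmorphM IHg IHh.
Qed.

(** Generic marks, so that every count arises by evaluation: double descents, double ascents, peaks,
    letters in front of 1, right-to-left minima, in this order. *)
Definition wring : comNzRingType := {mpoly int[5]}.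
Definition vx : wring := 'X_(@Ordinal 5 0 isT).
Definition vy : wring := 'X_(@Ordinal 5 1 isT).
Definition vp : wring := 'X_(@Ordinal 5 2 isT).
Definition vu : wring := 'X_(@Ordinal 5 3 isT).
Definition va : wring := 'X_(@Ordinal 5 4 isT).

Definition ins (f : wring) : wring :=
  vp * mderiv (@Ordinal 5 0 isT) f + vp * mderiv (@Ordinal 5 1 isT) f
  + vp * (vx + vy) * mderiv (@Ordinal 5 2 isT) f.

Lemma ins_derivation : derivation wring ins.
Proof.
split=> f g; rewrite /ins.
  by rewrite !mderivD; ring.
by rewrite !mderivM; ring.
Qed.

Lemma mderivXU (i j : 'I_5) : mderiv i ('X_j : {mpoly int[5]}) = (i == j)%:R.
Proof.
rewrite mderivX mnm1E eq_sym; case: eqP => [->|_]; last by rewrite scale0r.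
by rewrite scale1r -mpolyX0; congr 'X_[_]; apply/mnmP=> k; rewrite mnmBE subnn mnm0E.
Qed.

Lemma ins_vx : ins vx = vp.
Proof. by rewrite /ins !mderivXU /= !mulr0 !addr0 mulr1. Qed.
Lemma ins_vy : ins vy = vp.
Proof. by rewrite /ins !mderivXU /= !mulr0 add0r addr0 mulr1. Qed.
Lemma ins_vp : ins vp = vp * (vx + vy).
Proof. by rewrite /ins !mderivXU /= !mulr0 !add0r mulr1. Qed.
Lemma ins_vu : ins vu = 0.
Proof. by rewrite /ins !mderivXU /= !mulr0 !addr0. Qed.
Lemma ins_va : ins va = 0.
Proof. by rewrite /ins !mderivXU /= !mulr0 !addr0. Qed.

Definition wval {A : comNzRingType} (x y p u a : A) : {rmorphism wring -> A} :=
  mmap (intr : {rmorphism int -> A}) (fun i : 'I_5 => [:: x; y; p; u; a]`_i).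

Lemma wvalE (A : comNzRingType) (x y p u a : A) :
  (wval x y p u a vx = x) * (wval x y p u a vy = y) * (wval x y p u a vp = p) *
  (wval x y p u a vu = u) * (wval x y p u a va = a).
Proof. by rewrite /wval /= !mmapX !mmap1U. Qed.

Lemma iter_ins (c : wring) j :
  ins c = va * vp -> iter j.+1 ins c = va * iter j ins vp.
Proof.
move=> Dc; elim: j => [//|j IHj]; rewrite iterS IHj /=.
by rewrite -[va]expr1 der_const //; [exact: ins_derivation | exact: ins_va].
Qed.

(** The derivation sends [vx + vy] to [vp + vp] and [vp] to [vp * (vx + vy)], hence never leaves
    what these two elements generate. *)
Lemma generated_iter_ins j : generated wring (vx + vy) vp (iter j ins vp).
Proof.
elim: j => [|j IHj] /=; first exact: gen_p.
apply: generated_der => //; first exact: ins_derivation.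
  rewrite derD; last exact: ins_derivation.
  by rewrite ins_vx ins_vy; apply: gen_add; apply: gen_p.
by rewrite ins_vp; apply: gen_mul; [apply: gen_p | apply: gen_s].
Qed.

(** From [j = 1] on, the derivatives of both start elements are [va] times the same polynomial in
    [vx + vy] and [vp], which takes equal values at the two points; the last two hypotheses settle
    [j = 0]. *)
Lemma growth_wval (A : comNzRingType) (x y u x' y' u' p a : A) (c d : wring) n :
  x + y = x' + y' -> ins c = va * vp -> ins d = va * vp ->
  wval x y p u a c = a * (x + y) -> wval x' y' p u' a d = a * (x + y) ->
  wval x y p u a (growth wring ins c n) = wval x' y' p u' a (growth wring ins d n).
Proof.
move=> eqs Dc Dd vc vd; apply: growth_transfer; first exact: ins_derivation.
case=> [|j]; first by rewrite vc vd.
rewrite !iter_ins // !rmorphM !wvalE; congr (_ * _).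
by apply: generated_eq (generated_iter_ins j); rewrite ?rmorphD !wvalE.
Qed.

Lemma ins_start : ins (va * vy) = va * vp.
Proof. by rewrite (derM ins_derivation) ins_va ins_vy mul0r add0r. Qed.

Lemma ins_start_front : ins (vu + va * vy) = va * vp.
Proof. by rewrite (derD ins_derivation) ins_vu ins_start add0r. Qed.

(** * Inserting the largest letter into a word *)

Definition local_weight (a c d : nat) : wring :=
  if (a < c)%N then (if (c < d)%N then vy else vp)
  else (if (c < d)%N then 1 else vx).

(* The word is bordered by [a] on the left and by +oo on the right. *)
Fixpoint wshape (a : nat) (w : seq nat) : wring :=
  if w is c :: w' then
    (if w' is d :: _ then local_weight a c d else if (a < c)%N then vy else 1)
    * wshape c w'
  else 1.

Definition insert (N i : nat) (w : seq nat) : seq nat :=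
  take i w ++ N :: drop i w.

Lemma insert0 N w : insert N 0 w = N :: w.
Proof. by rewrite /insert take0 drop0. Qed.

Lemma insertS N i c w : insert N i.+1 (c :: w) = c :: insert N i w.
Proof. by []. Qed.

Lemma wshape_cons2 a c d w :
  wshape a (c :: d :: w) = local_weight a c d * wshape c (d :: w).
Proof. by []. Qed.

Lemma ins_local_weight a c d :
  ins (local_weight a c d) =
    if (a < c)%N then (if (c < d)%N then vp else vp * (vx + vy))
    else (if (c < d)%N then 0 else vp).
Proof.
rewrite /local_weight; case: ifP => _; case: ifP => _;
  rewrite ?ins_vy ?ins_vp ?ins_vx //; exact: der1 ins_derivation.
Qed.

(** The left neighbour matters only through its comparison with the first letter. *)
Lemma wshape_left_ge N c d w :
  (d <= c)%N -> (d <= N)%N -> wshape N (d :: w) = wshape c (d :: w).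
Proof.
by move=> dc dN; rewrite /= /local_weight !ltnNge dc dN.
Qed.

(* Inserting the new maximum next to a peak, on the left of a double ascent or
   on the right of a double descent differentiates the weight of that letter.
   If [c < a], the gap before [c] is one of the gaps of [a], whence the
   correction. *)
Lemma wshape_insert N a c w :
  all (gtn N) (a :: c :: w) ->
  \sum_(0 <= i < (size w).+1) wshape a (insert N i (c :: w)) =
    ins (wshape a (c :: w)) + (if (a < c)%N then 0 else vp * wshape a (c :: w)).
Proof.
elim: w a c => [|d w IHw] a c.
  move=> /=; rewrite andbT big_nat1 insert0 /= /local_weight => /andP[aN cN].
  rewrite aN ltnNge (ltnW cN) /= !mulr1.
  by case: ifP => _; rewrite ?ins_vy ?(der1 _ _ ins_derivation) ?mulr1 ?addr0 ?add0r.
rewrite [all _ _]/= => /and4P[aN cN dN wN].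
have Nc : (N < c)%N = false by apply/negbTE; rewrite -leqNgt ltnW.
have Nd : (N < d)%N = false by apply/negbTE; rewrite -leqNgt ltnW.
have {IHw} := IHw c d; rewrite [all _ _]/= cN dN wN => /(_ isT).
rewrite big_nat_recl // insert0 => IH.
rewrite !big_nat_recl // insert0 insertS insert0.
rewrite (eq_bigr (fun i => local_weight a c d * wshape c (d :: insert N i w))); last by [].
rewrite -mulr_sumr.
(* [T] gathers the gaps behind [d], shared by the induction hypothesis and the goal. Solving the
   former for [T] leaves a ring identity for each relative order of [a], [c], [d]. *)
move: IH; set T := \sum_(0 <= i < size w) _.
rewrite (wshape_cons2 a N c) !(wshape_cons2 a c) !(wshape_cons2 c N) (wshape_cons2 N c).
rewrite (derM ins_derivation) ins_local_weight.
have ZY : ~~ (c < d)%N -> wshape N (d :: w) = wshape c (d :: w).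
  by rewrite -leqNgt => dc; rewrite (wshape_left_ge N c) // ltnW.
set Z := wshape N (d :: w) in ZY *; set Y := wshape c (d :: w) in ZY *.
rewrite /local_weight aN cN Nc Nd => IH.
have {IH} -> : T = ins Y + (if (c < d)%N then 0 else vp * Y) - vp * Z.
  by rewrite -IH addrAC subrr add0r.
move: T Z Y ZY => _ Z Y ZY.
case: (c < d)%N ZY => [_|->] //; case: (a < c)%N; ring.
Qed.

Fixpoint rlmin (w : seq nat) : nat :=
  if w is c :: w' then (all (ltn c) w' + rlmin w')%N else 0%N.

Definition weight (a : nat) (w : seq nat) : wring := va ^+ rlmin w * wshape a w.

Lemma all_insert (P : pred nat) N i w : all P (insert N i w) = P N && all P w.
Proof. by rewrite /insert all_cat /= andbCA -all_cat cat_take_drop. Qed.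

Lemma size_insert N i w : size (insert N i w) = (size w).+1.
Proof. by rewrite /insert size_cat /= addnS -size_cat cat_take_drop. Qed.

(** A largest letter that is not last has a smaller letter on its right, and it never stops an
    earlier letter from being a minimum. *)
Lemma rlmin_insert N i w :
  all (gtn N) w -> (i < size w)%N -> rlmin (insert N i w) = rlmin w.
Proof.
elim: w i => [//|c w IHw] [|i] /= /andP[cN wN].
  by move=> _; rewrite (ltnNge N c) (ltnW cN).
by move=> ltiw; rewrite IHw // all_insert /= cN.
Qed.

(** The former last letter still has a larger right neighbour and keeps its type; the new one is a
    double ascent and a right-to-left minimum. *)
Lemma weight_insert_last N a w :
  all (gtn N) (a :: w) -> weight a (insert N (size w) w) = va * vy * weight a w.
Proof.
rewrite /weight => Nw.
have -> : insert N (size w) w = rcons w N.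
  by rewrite /insert take_size drop_size cats1.
have -> : rlmin (rcons w N) = (rlmin w).+1.
  case/andP: Nw => _; elim: w => //= c w IHw /andP[cN wN].
  by rewrite all_rcons /= cN IHw // addnS.
suff -> : wshape a (rcons w N) = vy * wshape a w by rewrite exprS; ring.
elim: w a Nw => [|c w IHw] a.
  by rewrite /= andbT => ->.
case: w IHw => [|d w] IHw; rewrite [all _ _]/= => /and3P[aN cN wN].
  by rewrite /= /local_weight cN; case: ifP => _; ring.
rewrite !rcons_cons !wshape_cons2 -rcons_cons IHw; last by rewrite /= cN.
by rewrite mulrCA.
Qed.

(** Since the border [a] is below every letter, the correction term of [wshape_insert] vanishes; the
    last gap gives the factor [va * vy]. *)
Lemma weight_insert N a w :
  all (gtn N) (a :: w) -> all (ltn a) w ->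
  \sum_(0 <= i < (size w).+1) weight a (insert N i w) =
    va * vy * weight a w + ins (weight a w).
Proof.
move=> Nw aw; rewrite big_nat_recr //= weight_insert_last // addrC; congr (_ + _).
rewrite (eq_big_nat _ _ (F2 := fun i => va ^+ rlmin w * wshape a (insert N i w))); last first.
  by move=> i /andP[_ ltiw]; rewrite /weight rlmin_insert //; case/andP: Nw.
rewrite -mulr_sumr /weight (der_const _ _ _ _ _ ins_derivation ins_va).
congr (_ * _); case: w Nw aw => [|c w] Nw aw.
  by rewrite big_nil (der1 _ _ ins_derivation).
by rewrite wshape_insert //; case/andP: aw => /= ->; rewrite addr0.
Qed.

(** * Sums over permutations, built by inserting the largest letter *)

Definition sum_perms (A : nmodType) (n : nat) (F : seq nat -> A) : A :=
  \sum_(w <- permutations (iota 1 n)) F w.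

Lemma perm_insert N i w : perm_eq (insert N i w) (N :: w).
Proof. by rewrite /insert perm_catC /= perm_cons perm_catC cat_take_drop. Qed.

(** Insertion is injective on pairs [(w, i)]: the place of [n.+1] gives back [i], and deleting it
    gives back [w]. Counting factorials makes it onto. *)
Lemma sum_permsS (A : nmodType) n (F : seq nat -> A) :
  sum_perms A n.+1 F =
    sum_perms A n (fun w => \sum_(0 <= i < n.+1) F (insert n.+1 i w)).
Proof.
rewrite /sum_perms.
pose L := [seq insert n.+1 i w | w <- permutations (iota 1 n), i <- iota 0 n.+1].
have wP w : w \in permutations (iota 1 n) -> (n.+1 \notin w) * (size w = n).
  rewrite mem_permutations => pw; rewrite (perm_size pw) size_iota (perm_mem pw).
  by rewrite mem_iota; split=> //; lia.
have iP w i : n.+1 \notin w -> size w = n -> i \in iota 0 n.+1 ->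
    index n.+1 (insert n.+1 i w) = i.
  rewrite mem_iota /= add0n ltnS => wN sw lein.
  rewrite /insert index_cat ifN; last by apply: contra wN => /mem_take.
  by rewrite /= eqxx addn0 size_takel // sw.
have uL : uniq L.
  apply: allpairs_uniq; rewrite ?permutations_uniq ?iota_uniq //.
  move=> p q /allpairsP[[w i] [/wP[wN sw] iN ->]] {p}
    /allpairsP[[w' i'] [/wP[wN' sw'] iN' ->]] {q} eqi.
  rewrite /uncurry in eqi; simpl fst in *; simpl snd in *.
  have eii : i = i' by rewrite -(iP _ _ wN sw iN) eqi iP.
  rewrite -eii in eqi *; congr (_, _).
  have sizes : size (take i w) = size (take i w') by rewrite !size_take sw sw'.
  move/eqP: eqi; rewrite /insert eqseq_cat // => /andP[/eqP et /eqP[ed]].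
  by rewrite -[w](cat_take_drop i) -[w'](cat_take_drop i) et ed.
have subL : {subset L <= permutations (iota 1 n.+1)}.
  move=> _ /allpairsP[[w i] [pw _ ->]]; rewrite !mem_permutations in pw *.
  rewrite (perm_trans (perm_insert _ _ _)) // -[X in iota 1 X]addn1 iotaD add1n.
  by rewrite -cat1s perm_catC perm_cat2r.
have sL : (size (permutations (iota 1 n.+1)) <= size L)%N.
  rewrite size_allpairs !size_permutations ?iota_uniq // !size_iota factS.
  by rewrite mulnC.
have [_ eqL] := uniq_min_size uL subL sL.
rewrite (perm_big L) /=; last first.
  by apply: uniq_perm; rewrite ?permutations_uniq // => w; rewrite eqL.
rewrite big_allpairs_dep /=.
by apply: eq_bigr => w _; rewrite /index_iota subn0.
Qed.

Lemma permutations_iotaP n w : w \in permutations (iota 1 n) ->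
  [/\ size w = n, uniq w, all (gtn n.+1) w & all (ltn 0) w].
Proof.
rewrite mem_permutations => pw; split.
- by rewrite (perm_size pw) size_iota.
- by rewrite (perm_uniq pw) iota_uniq.
- by apply/allP=> c; rewrite (perm_mem pw) mem_iota /=; lia.
- by apply/allP=> c; rewrite (perm_mem pw) mem_iota /=; lia.
Qed.

Lemma sum_weight n :
  sum_perms _ n (weight 0) = growth wring ins (va * vy) n.
Proof.
elim: n => [|n IHn]; first by rewrite /sum_perms big_seq1 /weight !mulr1.
rewrite sum_permsS /growth iterS -/(growth _ _ _ _) -IHn /sum_perms.
rewrite mulr_sumr (der_sum _ _ _ _ _ ins_derivation) -big_split /=.
apply: eq_big_seq => w /permutations_iotaP[sw _ wN w0].
by rewrite -{1}sw weight_insert //= wN.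
Qed.

(** The value 0 outside PRW lets the sum run over all permutations, where [sum_permsS] applies. *)
Definition prw_weight (w : seq nat) : wring :=
  let l := take (index 1%N w) w in
  if sorted gtn l then vu ^+ size l * weight 1 (drop (index 1%N w).+1 w) else 0.

Lemma prw_weight_cat l r : 1%N \notin l ->
  prw_weight (l ++ 1%N :: r) =
    if sorted gtn l then vu ^+ size l * weight 1 r else 0.
Proof.
move=> l1; rewrite /prw_weight index_cat (negbTE l1) /= addn0 take_size_cat //.
by rewrite -cat_rcons drop_size_cat // size_rcons.
Qed.

Lemma sorted_insert N i l : all (gtn N) l -> (i <= size l)%N ->
  sorted gtn (insert N i l) = (i == 0%N) && sorted gtn l.
Proof.
case: i l => [|i] [|c l] //= /andP[cN lN].
  by rewrite cN.
move=> _; apply/negbTE/negP => /(order_path_min (rev_trans ltn_trans)) /allP/(_ N).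
by rewrite mem_cat inE eqxx orbT => /(_ isT); lia.
Qed.

(* In a permutation of [PRW] the new maximum can only be put in front or to
   the right of the letter 1. *)
Lemma prw_weight_insert n w : w \in permutations (iota 1 n.+1) ->
  \sum_(0 <= i < n.+2) prw_weight (insert n.+2 i w) =
    (vu + va * vy) * prw_weight w + ins (prw_weight w).
Proof.
move=> wP; have [sw uw wN w0] := permutations_iotaP _ _ wP.
have w1 : 1%N \in w by rewrite mem_permutations in wP; rewrite (perm_mem wP) mem_iota.
case/splitPr: w1 uw sw wN w0 {wP} => l r.
rewrite cat_uniq /= !all_cat /= negb_or size_cat /=.
move=> /and3P[_ /andP[l1 _] /andP[r1 _]] sw /andP[lN rN] /andP[_ r0].
have r_gt1 : all (ltn 1) r.
  apply/allP=> c cr; have /= := allP r0 c cr.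
  by case: c cr => [//|[|//]] cr; rewrite cr in r1.
(* The gaps split at the letter 1: [(size l).+1] in front of it, the adjacent one included, and
   [(size r).+1] behind it. *)
have eN : n.+2 = ((size l).+1 + (size r).+1)%N by rewrite addSn sw.
have lins i : (0 <= i < (size l).+1)%N ->
    prw_weight (insert n.+2 i (l ++ 1%N :: r)) =
    if i == 0%N then vu * prw_weight (l ++ 1%N :: r) else 0.
  move=> /andP[_ leil]; have -> : insert n.+2 i (l ++ 1%N :: r) = insert n.+2 i l ++ 1%N :: r.
    rewrite /insert take_cat drop_cat -catA.
    case: ltnP => [//|ilel]; have -> : i = size l by apply/eqP; rewrite eqn_leq -ltnS leil.
    by rewrite subnn take0 drop0 take_size drop_size cats0.
  rewrite !prw_weight_cat //; last first.
    by rewrite -has_pred1 -all_predC all_insert all_predC has_pred1.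
  rewrite sorted_insert // size_insert; case: eqP => //= _; case: ifP => _; last by rewrite mulr0.
  by rewrite exprS mulrA.
have rins j : prw_weight (insert n.+2 ((size l).+1 + j) (l ++ 1%N :: r)) =
    if sorted gtn l then vu ^+ size l * weight 1 (insert n.+2 j r) else 0.
  rewrite -prw_weight_cat //; congr prw_weight.
  rewrite addSnnS /insert take_cat drop_cat ltnNge leq_addr /=.
  by rewrite addKn -catA.
rewrite [X in index_iota 0 X]eN (big_cat_nat (n := (size l).+1)) ?leq_addr //=.
rewrite (eq_big_nat _ _ lins) big_nat_recl // big1_seq ?addr0; last first.
  by move=> i _.
rewrite -{1}[(size l).+1]add0n big_addn addKn.
under eq_bigr => j _ do rewrite addnC rins.
rewrite mulrDl -addrA prw_weight_cat //; congr (_ + _).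
case: ifP => _; last by rewrite big1 // mulr0 (der0 _ _ ins_derivation) addr0.
rewrite -mulr_sumr weight_insert //.
rewrite mulrDr [vu ^+ _ * (va * vy * _)]mulrCA; congr (_ + _).
exact/esym/(der_const _ _ _ _ _ ins_derivation ins_vu).
Qed.

Lemma sum_prw_weight n :
  sum_perms _ n.+1 prw_weight = growth wring ins (vu + va * vy) n.
Proof.
elim: n => [|n IHn].
  by rewrite /sum_perms big_seq1 /= /prw_weight /= /weight /= !mulr1.
rewrite sum_permsS /growth iterS -/(growth _ _ _ _) -IHn /sum_perms.
rewrite mulr_sumr (der_sum _ _ _ _ _ ins_derivation) -big_split /=.
by apply: eq_big_seq => w /prw_weight_insert.
Qed.

(** * Permutations as words *)

(** One counter for all local statistics: [P] tests each letter together with its two neighbours,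
    the word being bordered by [a] and [b]. *)
Fixpoint count3 (P : nat -> nat -> nat -> bool) (a : nat) (w : seq nat) (b : nat) : nat :=
  if w is c :: w' then (P a c (head b w') + count3 P c w' b)%N else 0%N.

Lemma count3E P a w b :
  count3 P a w b = (\sum_(i < size w)
    let t := a :: rcons w b in P (nth 0%N t i) (nth 0%N t i.+1) (nth 0%N t i.+2))%N.
Proof.
elim: w a => [|c w IHw] a; first by rewrite big_ord0.
rewrite /= big_ord_recl /= IHw; congr (nat_of_bool (P _ _ _) + _)%N.
by case: w {IHw}.
Qed.

Lemma count3_cat P a l c r b :
  count3 P a (l ++ c :: r) b =
    (count3 P a l c + P (last a l) c (head b r) + count3 P c r b)%N.
Proof.
elim: l a => [|d l IHl] a //=; rewrite IHl !addnA; congr (nat_of_bool (P _ _ _) + _ + _ + _)%N.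
by case: l {IHl}.
Qed.

Definition is_peak (a c d : nat) := (a < c)%N && (d < c)%N.
Definition is_dasc (a c d : nat) := (a < c)%N && (c < d)%N.
Definition is_ddes (a c d : nat) := (c < a)%N && (d < c)%N.

Lemma neq_head_rcons (c : nat) w b : c \notin rcons w b -> c != head b w.
Proof.
apply: contraNneq => ->; rewrite mem_rcons.
by case: w => [|d w]; rewrite !inE eqxx ?orbT.
Qed.

Lemma count3_asc a w b : uniq (rcons w b) ->
  count3 (fun a' c _ => a' < c)%N a w b =
    (count3 is_peak a w b + count3 is_dasc a w b)%N.
Proof.
elim: w a => //= c w IHw a /andP[cw uw]; rewrite IHw // addnACA; congr (_ + _)%N.
have := neq_head_rcons _ _ _ cw.
by rewrite /is_peak /is_dasc; case: (ltngtP c (head b w)) => // _ _; case: (a < c)%N.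
Qed.

Lemma count3_des a w b : uniq (a :: w) ->
  count3 (fun _ c d => d < c)%N a w b =
    (count3 is_peak a w b + count3 is_ddes a w b)%N.
Proof.
elim: w a => // c w IHw a /= /andP[acw cw]; rewrite IHw // addnACA; congr (_ + _)%N.
have: a != c by apply: contraNneq acw => ->; rewrite mem_head.
by rewrite /is_peak /is_ddes; case: (ltngtP a c) => // _ _; case: (_ < c)%N.
Qed.

(** Peaks and valleys alternate and the word finally rises to [b], so there are as many valleys as
    peaks, and one more if it starts by going down from [a]. *)
Lemma count3_size a w b : uniq (a :: rcons w b) -> all (gtn b) (a :: w) ->
  size w = ((count3 is_peak a w b).*2 + count3 is_dasc a w b + count3 is_ddes a w b
            + (head b w < a))%N.
Proof.
elim: w a => [|c w IHw] a /=.
  by move=> _ /andP[ab _]; rewrite (ltnNge b a) (ltnW ab).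
move=> /andP[acw cwb] /and3P[ab cb wb]; rewrite {1}(IHw c cwb) /=; last by rewrite cb.
have: a != c by apply: contraNneq acw => ->; rewrite mem_head.
have : c != head b w by case/andP: cwb => /neq_head_rcons.
rewrite /is_peak /is_dasc /is_ddes.
by case: (ltngtP a c) => // _; case: (ltngtP c) => // _ _ _ /=; lia.
Qed.

Lemma wshape_count3 a w b : uniq (a :: rcons w b) -> all (gtn b) w ->
  wshape a w = vx ^+ count3 is_ddes a w b * vy ^+ count3 is_dasc a w b
              * vp ^+ count3 is_peak a w b.
Proof.
elim: w a => [|c w IHw] a; first by rewrite /= !mulr1.
move=> /= /andP[acw cwb] /andP[cb wb].
rewrite IHw //.
have -> : (if w is d :: _ then local_weight a c d else if (a < c)%N then vy else 1) =
  local_weight a c (head b w).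
  by case: (w) => //=; rewrite /local_weight cb.
have: a != c by apply: contraNneq acw => ->; rewrite mem_head.
have : c != head b w by case/andP: cwb => /neq_head_rcons.
rewrite /is_peak /is_dasc /is_ddes /local_weight.
by case: (ltngtP a c) => // _; case: (ltngtP c) => // _ _ _ /=; rewrite ?add0n ?add1n ?exprS; ring.
Qed.

(** * The word of a permutation and its statistics *)

Definition word (n : nat) (s : 'S_n) : seq nat := [seq letter s i | i <- iota 1 n].

Lemma letterS n (s : 'S_n) (i : 'I_n) : letter s i.+1 = (s i).+1.
Proof. by rewrite /letter valK. Qed.

Lemma letter_out n (s : 'S_n) i : (n <= i)%N -> letter s i.+1 = n.+1.
Proof. by move=> lein; rewrite /letter insubF // ltnNge lein. Qed.

Lemma size_word n (s : 'S_n) : size (word n s) = n.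
Proof. by rewrite size_map size_iota. Qed.

Lemma nth_word n (s : 'S_n) i : (i < n)%N -> nth 0%N (word n s) i = letter s i.+1.
Proof. by move=> ltin; rewrite (nth_map 0%N) ?size_iota // nth_iota. Qed.

Lemma nth_wordE n (s : 'S_n) (i : 'I_n) : nth 0%N (word n s) i = (s i).+1.
Proof. by rewrite nth_word // letterS. Qed.

Lemma nth_rcons_word n (s : 'S_n) i : (i <= n)%N ->
  nth 0%N (rcons (word n s) n.+1) i = letter s i.+1.
Proof.
rewrite nth_rcons size_word leq_eqVlt => /orP[/eqP->|ltin].
  by rewrite ltnn eqxx letter_out.
by rewrite ltin nth_word.
Qed.

Lemma wordE n (s : 'S_n) : word n s = [seq (s i).+1 | i <- enum 'I_n].
Proof.
rewrite /word (iotaDl 1 0) -val_enum_ord -!map_comp; apply: eq_map => i.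
exact: letterS.
Qed.

Lemma perm_word n (s : 'S_n) : perm_eq (word n s) (iota 1 n).
Proof.
have uw : uniq (word n s).
  rewrite wordE map_inj_uniq ?enum_uniq // => i j [eqij].
  exact/(perm_inj (s := s))/val_inj.
have sub : {subset word n s <= iota 1 n}.
  by move=> c; rewrite wordE => /mapP[i _ ->]; rewrite mem_iota /= add1n ltnS ltn_ord.
have [|_ eqw] := uniq_min_size uw sub; first by rewrite size_word size_iota.
by apply: uniq_perm; rewrite ?iota_uniq.
Qed.

Lemma word_inj n : injective (word n).
Proof.
move=> s t eqw; apply/permP=> i; apply/val_inj; apply: succn_inj.
by rewrite -!nth_wordE eqw.
Qed.

Lemma sum_word (A : nmodType) n (F : seq nat -> A) :
  \sum_(s : 'S_n) F (word n s) = sum_perms A n F.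
Proof.
have uS : uniq [seq word n s | s <- enum 'S_n] by rewrite (map_inj_uniq (@word_inj n)) enum_uniq.
have sub : {subset [seq word n s | s <- enum 'S_n] <= permutations (iota 1 n)}.
  by move=> _ /mapP[s _ ->]; rewrite mem_permutations perm_word.
have [|_ eqS] := uniq_min_size uS sub.
  by rewrite size_permutations ?iota_uniq // size_iota size_map -cardE card_Sn.
rewrite /sum_perms (perm_big [seq word n s | s <- enum 'S_n]) /=.
  by rewrite big_map big_enum.
by apply: uniq_perm; rewrite ?permutations_uniq // => w; rewrite eqS.
Qed.

Lemma card_set_sum n (P : pred 'I_n) : #|[set i | P i]| = (\sum_(i < n) P i)%N.
Proof.
by rewrite -sum1dep_card big_mkcond; apply: eq_bigr => i _; case: (P i).
Qed.

Lemma nth_border n (s : 'S_n) a i : (0 < i <= n.+1)%N ->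
  nth 0%N (a :: rcons (word n s) n.+1) i = letter s i.
Proof. by case: i => // i /andP[_ lein]; apply: nth_rcons_word. Qed.

Lemma peaks_word n (s : 'S_n) : peaks s = count3 is_peak n.+1 (word n s) n.+1.
Proof.
rewrite /peaks card_set_sum count3E size_word; apply: eq_bigr => i _.
have lti := ltn_ord i; have lei := ltnW lti.
rewrite /is_peak /peak [nth _ _ i.+1]nth_border // [nth _ _ i.+2]nth_border //.
case: (nat_of_ord i) lti lei => [|j] ltj lej //.
by rewrite nth_border //; exact: ltnW lej.
Qed.

Lemma double_ascent_word n (s : 'S_n) :
  [forall i : 'I_n, ~~ double_ascent s i.+1] =
    (count3 is_dasc n.+1 (word n s) n.+1 == 0%N).
Proof.
rewrite count3E size_word sum_nat_eq0; apply: eq_forallb => i /=; rewrite eqb0.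
congr (~~ _); rewrite /is_dasc /double_ascent !nth_rcons_word //; last by rewrite ltnW.
by case: i => [[|j] ltj] //=; rewrite nth_rcons_word // ltnW // ltnW.
Qed.

(** An ascent is charged to its upper letter; the left border [n.+1] keeps the first letter from
    being counted. *)
Lemma asc_word n (s : 'S_n) :
  asc s = count3 (fun a c _ => a < c)%N n.+1 (word n s) n.+1.
Proof.
rewrite /asc card_set_sum count3E size_word; apply: eq_bigr => -[[|j] ltj] _ /=.
  by rewrite /ascent nth_rcons_word // (letterS n s (Ordinal ltj)) ltnNge !ltnS ltnW ?ltn_ord.
by rewrite /ascent /= ltj !nth_rcons_word // ltnW // ltnW.
Qed.

Lemma des_word n (s : 'S_n) a :
  des s = count3 (fun _ c d => d < c)%N a (word n s) n.+1.
Proof.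
rewrite /des card_set_sum count3E size_word.
case: n s => [|n] s; first by rewrite !big_ord0.
move: (word _ s) (nth_rcons_word _ s) => w wE.
(* Index 0 is never a descent, and the last letter is followed by +oo: both terms are split off,
   which absorbs the shift by one between the sums. *)
rewrite big_ord_recl big_ord_recr /= add0n !wE ?leqnSn // letter_out // (letterS _ s ord_max).
have -> : (n.+2 < (s ord_max).+1)%N = false.
  by apply/negbTE; rewrite -leqNgt ltnW // ltnS.
rewrite addn0.
apply: eq_bigr => i _; rewrite /descent /= /bump add1n ltnS ltn_ord /=.
have ltin := ltn_ord i; have lein := ltnW ltin.
by rewrite [nth _ _ i.+1]wE // [nth _ _ i]wE // ltnW.
Qed.

(** The borders 0 and [n.+1] keep the first and the last letter from being double descents, in
    agreement with [1 < i < n]. *)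
Lemma Gamma3_word n (s : 'S_n) :
  [forall i : 'I_n, ~~ [&& 1 < i, letter s i.-1 > letter s i
                         & letter s i > letter s i.+1]]%N =
    (count3 is_ddes 0 (word n s) n.+1 == 0%N).
Proof.
rewrite count3E size_word sum_nat_eq0.
apply/forallP/forallP => [noDD [[|j] ltj]|noDD [[|[|j]] ltj] //].
- by rewrite eqb0 /is_ddes ltn0.
- have lej := ltnW ltj; have lej' := ltnW lej.
  rewrite eqb0 /is_ddes /= !nth_rcons_word //.
  have [ltjn|lejn] := ltnP j.+2 n; first exact: (noDD (Ordinal ltjn)).
  rewrite (letter_out _ s _ lejn) (letterS _ s (Ordinal ltj)) negb_and -!leqNgt.
  by rewrite (leq_trans (ltn_ord _)) ?orbT.
have lej := ltnW ltj; have lej' := ltnW lej; have lej2 := ltnW lej'.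
by have := noDD (Ordinal lej); rewrite eqb0 /is_ddes /= !nth_rcons_word.
Qed.

Lemma rlminE w : rlmin w =
  (\sum_(i < size w) [forall j : 'I_(size w), (i < j) ==> (nth 0%N w i < nth 0%N w j)])%N.
Proof.
elim: w => [|c w IHw]; first by rewrite big_ord0.
rewrite /= big_ord_recl /= IHw; congr (nat_of_bool _ + _)%N.
  apply/(all_nthP 0%N)/forallP => /= [cw [[|j] ltj] //=|cw j ltj]; first exact: cw.
  exact: (cw (Ordinal (ltj : (j.+1 < (size w).+1)%N))).
apply: eq_bigr => i _; congr nat_of_bool.
apply/forallP/forallP => /= [iw [[|j] ltj] //=|iw j].
  exact: (iw (Ordinal (ltj : (j < size w)%N))).
exact: (iw (lift ord0 j)).
Qed.

Lemma RLmin_word n (s : 'S_n) : RLmin s = rlmin (word n s).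
Proof.
rewrite /RLmin card_set_sum rlminE size_word; apply: eq_bigr => i _.
by congr nat_of_bool; apply: eq_forallb => j; rewrite !nth_wordE.
Qed.

(** * Words of PRW, cut at the letter 1 *)

Lemma word_split n (s : 'S_n.+1) : exists l r : seq nat,
  [/\ word n.+1 s = l ++ 1%N :: r, size l + size r = n, uniq (word n.+1 s),
      all (ltn 1) (l ++ r) & all (gtn n.+2) (l ++ 1%N :: r)]%N.
Proof.
have pw := perm_word _ s; move: (word _ s) pw (size_word _ s) => w pw sw.
have uw : uniq w by rewrite (perm_uniq pw) iota_uniq.
have mw c : c \in w -> (0 < c < n.+2)%N by rewrite (perm_mem pw) mem_iota add1n.
have w1 : 1%N \in w by rewrite (perm_mem pw) mem_iota.
case/splitPr: w1 uw mw sw {pw} => l r uw mw sw.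
exists l, r; split=> //.
- by move: sw; rewrite size_cat /= addnS => -[].
- apply/allP=> c clr /=.
  have: c != 1%N.
    move: uw; rewrite uniq_catC /= mem_cat orbC -mem_cat => /andP[+ _].
    by apply: contraNneq => <-.
  have := mw c; rewrite mem_cat inE orbCA -mem_cat clr orbT => /(_ isT).
  by case: c {clr} => [|[]].
- by apply/allP=> c /mw /andP[].
Qed.

(** The letter 1 starts an ascent unless it is last, so the condition on the first ascent says that
    the word decreases up to 1. *)
Lemma PRW_word n (s : 'S_n.+1) l r : word n.+1 s = l ++ 1%N :: r ->
  (size l + size r)%N = n -> uniq (word n.+1 s) -> all (ltn 1) (l ++ r) ->
  (s \in PRW n.+1) = sorted gtn l.
Proof.
move=> ew sw uw lr_gt1.
have wE i : (i <= n)%N -> nth 0%N (l ++ 1%N :: r) i = letter s i.+1.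
  by move=> lein; rewrite -ew nth_word.
have letter1 : letter s (size l).+1 = 1%N.
  by rewrite -wE -?sw ?leq_addr // nth_cat ltnn subnn.
have letter_inj i j : (i <= n)%N -> (j <= n)%N -> letter s i.+1 = letter s j.+1 -> i = j.
  move=> lein lejn; rewrite -!wE // -ew => /eqP.
  by rewrite nth_uniq ?size_word // => /eqP.
have letter_gt1 i : (i <= n)%N -> i != size l -> (1 < letter s i.+1)%N.
  move=> lein nil.
  have: letter s i.+1 != 1%N.
    by apply: contraNneq nil; rewrite -letter1 => /letter_inj -> //; rewrite -sw leq_addr.
  by rewrite (letterS _ s (Ordinal (lein : (i < n.+1)%N))); case: (s _ : nat).
have lelN : (size l <= n)%N by rewrite -sw leq_addr.
have ascE i : (i < n)%N -> ascent s i.+1 = (letter s i.+1 < letter s i.+2)%N.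
  by move=> ltin; rewrite /ascent /= ltnS ltin.
rewrite inE; apply/forallP/idP => [prw|sl i].
  (* By strong induction, an ascent at [i <= size l] would be the first one, hence at the letter 1,
     which stands at [(size l).+1]. *)
  have noasc i : (i <= size l)%N -> ~~ ascent s i.
    elim/ltn_ind: i => i IHi leil; apply/negP => asci.
    have ltin : (i < n.+1)%N by rewrite ltnS (leq_trans leil).
    have := prw (Ordinal ltin); rewrite /first_ascent /= asci /=.
    move=> /implyP/(_ _)/eqP; case: forallP => [_ /(_ isT)|[] j]; last first.
      by apply/implyP => ltji; apply: IHi => //; apply: leq_trans (ltnW ltji) leil.
    case: i {IHi asci} leil ltin => [//|i] leil ltin li1.
    by have := letter_gt1 i (ltnW ltin); rewrite li1 ltnn neq_ltn leil => /(_ isT).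
  apply/(sortedP 0%N) => i ltil.
  have ltin : (i.+1 <= n)%N := leq_trans (ltnW ltil) lelN.
  have := noasc i.+1 (ltnW ltil); rewrite ascE // -leqNgt.
  rewrite leq_eqVlt => /orP[/eqP/letter_inj|].
    by move=> /(_ ltin (ltnW ltin)) /eqP; rewrite -[X in _ == X]addn0 -addn1 eqn_add2l.
  by rewrite -!wE ?(ltnW ltin) // !nth_cat ltil (ltnW ltil).
apply/implyP => /andP[asci /forallP first].
case: (nat_of_ord i) (ltn_ord i) asci first => [//|j] ltj.
rewrite ltnS in ltj; rewrite ascE // => lt_letter first.
(* Before the letter 1 the word descends, and beyond it the ascent at 1 would come earlier. *)
have [ltjl|gtjl|->] := ltngtP j (size l); last by rewrite letter1.
  have [eqj|ltj1l] := leqP (size l) j.+1.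
    have ejl : size l = j.+1 by apply/eqP; rewrite eqn_leq eqj ltjl.
    have := letter_gt1 j (ltnW ltj); rewrite (ltn_eqF ltjl) => /(_ isT) /ltnW.
    by move: lt_letter; rewrite -[j.+2]/(j.+1.+1) -ejl letter1 ltnNge => /negbTE ->.
  move: lt_letter; rewrite -!wE // ?(ltnW ltj) // !nth_cat ltjl ltj1l ltnNge ltnW //.
  by move/(sortedP 0%N): sl => /(_ j ltj1l).
have ltl : ((size l).+1 < n.+1)%N by rewrite ltnS (leq_trans gtjl (ltnW ltj)).
have := first (Ordinal ltl); rewrite [nat_of_ord _]/= ltnS gtjl.
rewrite ascE ?(leq_trans gtjl (ltnW ltj)) // letter1.
by rewrite letter_gt1 ?(leq_trans gtjl (ltnW ltj)) // gtn_eqF.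
Qed.

(** The letters of [l] followed by 1 decrease, so all of them are minima, and 1 rules out every
    later letter. *)
Lemma LRmin_word n (s : 'S_n.+1) l r : word n.+1 s = l ++ 1%N :: r ->
  (size l + size r)%N = n -> all (ltn 1) (l ++ r) -> sorted gtn l ->
  LRmin s = (size l).+1.
Proof.
rewrite all_cat => ew sw /andP[l1 r1] sl.
have lelN : ((size l).+1 <= n.+1)%N by rewrite ltnS -sw leq_addr.
have sl1 : sorted gtn (rcons l 1%N).
  move: sl; rewrite !(sorted_pairwise (rev_trans ltn_trans)) pairwise_rcons => ->.
  by rewrite andbT.
have nthE i : (i <= size l)%N -> nth 0%N (l ++ 1%N :: r) i = nth 0%N (rcons l 1%N) i.
  by move=> leil; rewrite -cat_rcons nth_cat size_rcons ltnS leil.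
transitivity (\sum_(i < (size l).+1) 1)%N; last by rewrite sum1_card card_ord.
rewrite (big_ord_widen _ (fun=> 1%N) lelN) /LRmin -sum1dep_card; apply: eq_bigl => i.
have wE (j : 'I_n.+1) : (s j).+1 = nth 0%N (l ++ 1%N :: r) j by rewrite -ew nth_wordE.
rewrite ltnS; apply/forallP/idP => [lri|leil j].
  rewrite leqNgt; apply/negP => ltli.
  have := implyP (lri (Ordinal lelN)) ltli.
  by rewrite -ltnS !wE [nat_of_ord (Ordinal _)]/= (nthE (size l)) // nth_rcons ltnn eqxx -wE.
apply/implyP => ltji; rewrite -ltnS !wE !nthE ?(leq_trans (ltnW ltji)) //.
have := sorted_ltn_nth (rev_trans ltn_trans) 0%N sl1; apply => //.
  by rewrite inE size_rcons ltnS (leq_trans (ltnW ltji)).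
by rewrite inE size_rcons ltnS.
Qed.

Lemma rlmin_cat l c r : all (ltn c) l -> rlmin (l ++ c :: r) = rlmin (c :: r).
Proof.
elim: l => [//|d l IHl] /= /andP[cd cl].
rewrite IHl // all_cat /= (ltnNge d c) (ltnW cd) /= andbF; exact: add0n.
Qed.

Lemma count3_decreasing P a l c : (forall a' c' d, (c' < a')%N -> P a' c' d = false) ->
  path gtn a l -> count3 P a l c = 0%N.
Proof.
move=> P0; elim: l a => [//|d l IHl] a /= /andP[da dl].
by rewrite P0 // IHl.
Qed.

(** From the border through [l] to 1 the word decreases, which contributes nothing to a [P] that
    fails after a fall. *)
Lemma count3_prw P b l r : (forall a' c' d, (c' < a')%N -> P a' c' d = false) ->
  sorted gtn l -> all (ltn 1) l -> all (gtn b) (l ++ 1%N :: r) ->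
  count3 P b (l ++ 1%N :: r) b = count3 P 1 r b.
Proof.
rewrite all_cat => P0 sl l1 /and3P[lb b1 _].
rewrite count3_cat count3_decreasing //; last first.
  by rewrite (path_sortedE (rev_trans ltn_trans)) lb.
by rewrite P0 //; case/lastP: l lb l1 {sl} => // l d; rewrite last_rcons !all_rcons => _ /andP[].
Qed.

Lemma count3_des_prw a b l r : sorted gtn l -> all (ltn 1) (l ++ r) -> (1 < b)%N ->
  count3 (fun _ c d => d < c)%N a (l ++ 1%N :: r) b =
    (size l + count3 (fun _ c d => d < c)%N 1 r b)%N.
Proof.
rewrite all_cat => sl /andP[l1 r1] b1; rewrite count3_cat /=.
have -> : (head b r < 1)%N = false.
  by case: r r1 => [|c r] /= => [_|/andP[c1 _]]; rewrite ltnNge ltnW.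
rewrite addn0; congr (_ + _)%N.
elim: l a sl l1 => [//|c l IHl] a /= sl /andP[c1 l1].
rewrite (IHl _ (path_sorted sl) l1).
by case: l sl {IHl l1} => [|d l] /= => [_|/andP[-> _]] //; rewrite c1.
Qed.

(** Taking [a * x] for [vu] counts each letter in front of 1 both as a left-to-right minimum and as
    a descent. A peak closes an ascent and opens a descent, hence the differences in the
    exponents. *)
Lemma PRW_stats n (s : 'S_n.+1) (A : comNzRingType) (x y p a : A) : s \in PRW n.+1 ->
  [/\ wval x y p (a * x) a (prw_weight (word n.+1 s)) =
        a ^+ (LRmin s + RLmin s - 2) * (x ^+ (des s - peaks s)
        * y ^+ (asc s - peaks s) * p ^+ peaks s),
      (peaks s <= des s)%N, (peaks s <= asc s)%N, (des s + asc s)%N = n &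
      [forall i : 'I_n.+1, ~~ double_ascent s i.+1] = (asc s == peaks s)].
Proof.
have [l [r [ew sw uw lr1 lrb]]] := word_split _ s.
rewrite (PRW_word _ _ _ _ ew sw uw lr1) => sl.
rewrite (LRmin_word _ _ _ _ ew sw lr1 sl) double_ascent_word RLmin_word peaks_word.
rewrite asc_word (des_word _ _ 0) ew.
have [l1 r1] : all (ltn 1) l /\ all (ltn 1) r by apply/andP; rewrite -all_cat.
have rb : all (gtn n.+2) r by move: lrb; rewrite all_cat => /andP[_ /andP[]].
have l1' : 1%N \notin l by apply/negP => /(allP l1).
have r1' : 1%N \notin r by apply/negP => /(allP r1).
have br : n.+2 \notin r by apply/negP => /(allP rb); rewrite /= ltnn.
have ur : uniq r by move: uw; rewrite ew cat_uniq => /and3P[_ _ /andP[]].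
have urb : uniq (rcons r n.+2) by rewrite rcons_uniq br.
have u1rb : uniq (1%N :: rcons r n.+2) by rewrite /= mem_rcons inE r1'.
have head_r : (head n.+2 r < 1)%N = false.
  by case: (r) r1 => [|c r'] //= /andP[c1 _]; rewrite ltnNge ltnW.
rewrite !count3_prw //; try by move=> a' c' d /ltnW; rewrite leqNgt => /negbTE ac;
  rewrite ?/is_peak ?/is_dasc ac.
rewrite (count3_des_prw _ _ _ _ sl lr1) // count3_asc // count3_des ?cons_uniq ?r1' //.
rewrite rlmin_cat // prw_weight_cat // sl /= r1 /weight (wshape_count3 _ _ _ u1rb rb).
have := count3_size _ _ _ u1rb; rewrite /= rb head_r addn0 => /(_ isT).
move: (count3 is_peak _ _ _) (count3 is_dasc _ _ _) (count3 is_ddes _ _ _).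
move=> pk da dd sr.
split; [|by rewrite addnCA leq_addr | by rewrite leq_addr
  | by rewrite -[RHS]sw sr -addnn; ring | by rewrite -{2}[pk]addn0 eqn_add2l].
rewrite !rmorphM !rmorphXn !wvalE.
rewrite addSn add1n addnS !subSS subn0 addnCA !addKn exprMn !exprD.
by ring.
Qed.

(** Here [e] and [d] count double descents and double ascents. Between the borders 0 and +oo valleys
    and peaks are equally many, and [des s - e] is the number of peaks. *)
Lemma Gamma3_stats n (s : 'S_n) (A : comNzRingType) (x y p u a : A) :
  exists e d, [/\ wval x y p u a (weight 0 (word n s)) =
        a ^+ RLmin s * (x ^+ e * y ^+ d * p ^+ (des s - e)),
      (n = (des s - e).*2 + d + e)%N, (e <= des s)%N &
      [forall i : 'I_n, ~~ [&& 1 < i, letter s i.-1 > letter s i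
                         & letter s i > letter s i.+1]]%N = (e == 0%N)].
Proof.
exists (count3 is_ddes 0 (word n s) n.+1), (count3 is_dasc 0 (word n s) n.+1).
rewrite Gamma3_word RLmin_word (des_word _ _ 0).
have wP : word n s \in permutations (iota 1 n) by rewrite mem_permutations perm_word.
have [sw uw wn w0] := permutations_iotaP _ _ wP.
have u0 : uniq (0%N :: rcons (word n s) n.+1).
  rewrite /= rcons_uniq uw mem_rcons inE andbT /=.
  by apply/andP; split; apply/negP; [move=> /(allP w0) | move=> /(allP wn); rewrite /= ltnn].
have u0w : uniq (0%N :: word n s).
  by move: u0; rewrite -rcons_cons rcons_uniq => /andP[].
have := count3_size _ _ _ u0; rewrite /= wn addn0 sw => /(_ isT) size_w.
rewrite count3_des // addnK /weight (wshape_count3 _ _ _ u0 wn); split=> //; last exact: leq_addl.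
by rewrite !rmorphM !rmorphXn !wvalE.
Qed.

(** * The expansion *)

Lemma prw_weight_notin n (s : 'S_n.+1) :
  s \notin PRW n.+1 -> prw_weight (word n.+1 s) = 0.
Proof.
have [l [r [ew sw uw lr1 _]]] := word_split _ s.
rewrite (PRW_word _ _ _ _ ew sw uw lr1) ew => /negbTE sl.
rewrite prw_weight_cat ?sl //; apply/negP => l1.
by have := allP lr1 1%N; rewrite mem_cat l1 => /(_ isT).
Qed.

Lemma wval_growth_PRW n (A : comNzRingType) (x y p a : A) :
  wval x y p (a * x) a (growth wring ins (vu + va * vy) n) =
    \sum_(s in PRW n.+1) a ^+ (LRmin s + RLmin s - 2) *
      (x ^+ (des s - peaks s) * y ^+ (asc s - peaks s) * p ^+ peaks s).
Proof.
rewrite -sum_prw_weight -sum_word rmorph_sum [RHS]big_mkcond; apply: eq_bigr => s _.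
case: ifPn => [/PRW_stats-/(_ A x y p a)[-> //]|/prw_weight_notin ->].
exact: rmorph0.
Qed.

Lemma sum_by_value (A : nmodType) (I : finType) (P : pred I) (c : I -> nat) m
    (F : I -> A) : (forall i, P i -> c i <= m)%N ->
  \sum_(i | P i) F i = \sum_(0 <= k < m.+1) \sum_(i | P i && (c i == k)) F i.
Proof.
move=> cm; rewrite (partition_big (fun i => inord (c i) : 'I_m.+1) predT) //= big_mkord.
apply: eq_bigr => k _; apply: eq_bigl => i; apply: andb_id2l => Pi.
by rewrite -val_eqE /= inordK // ltnS cm.
Qed.

(** The value 0 for [vy] kills the words with a double ascent; in the others the [k] ascents all end
    in peaks and [des s - k = n - 2k]. *)
Lemma wval_growth_Gamma1 n (A : comNzRingType) (x p a : A) :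
  wval x 0 p (a * x) a (growth wring ins (vu + va * vy) n) =
    \sum_(0 <= k < n./2.+1) (\sum_(s in Gamma1 n k) a ^+ (LRmin s + RLmin s - 2))
      * (p ^+ k * x ^+ (n - 2 * k)).
Proof.
rewrite wval_growth_PRW (bigID (fun s => asc s == peaks s)) /= [X in _ + X]big1 ?addr0; last first.
  move=> s /andP[/PRW_stats-/(_ A x 0 p a)[_ _ pka _ _] nea].
  by rewrite expr0n subn_eq0 leqNgt ltn_neqAle pka eq_sym nea !mulr0 ?mul0r ?mulr0.
rewrite (sum_by_value _ _ _ (fun s => asc s) n./2); last first.
  move=> s /andP[/PRW_stats-/(_ A x 0 p a)[_ pkd _ en _] /eqP ea].
  by rewrite ea geq_half_double -[X in (_ <= X)%N]en ea -addnn leq_add2r.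
apply: eq_bigr => k _; rewrite mulr_suml; apply: eq_big => s.
  rewrite /Gamma1 [RHS]inE -andbA; apply: andb_id2l.
  by move=> /PRW_stats-/(_ A x 0 p a)[_ _ _ _ ->]; rewrite andbC.
move=> /andP[/andP[/PRW_stats-/(_ A x 0 p a)[_ _ _ en _] /eqP ea] /eqP ek].
rewrite -ea ek subnn expr0 mulr1 -[in (n - _)%N]en ek mul2n -addnn subnDr.
by rewrite [p ^+ k * _]mulrC.
Qed.

(** With equal marks the exponents [des s - k] and [asc s - k] add up to [n - 2k]. *)
Lemma wval_growth_Gamma2 n (A : comNzRingType) (x p a : A) :
  wval x x p (a * x) a (growth wring ins (vu + va * vy) n) =
    \sum_(0 <= k < n./2.+1) (\sum_(s in Gamma2 n k) a ^+ (LRmin s + RLmin s - 2))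
      * (p ^+ k * x ^+ (n - 2 * k)).
Proof.
rewrite wval_growth_PRW (sum_by_value _ _ _ (fun s => peaks s) n./2); last first.
  move=> s /PRW_stats-/(_ A x x p a)[_ pkd pka en _].
  by rewrite geq_half_double -[X in (_ <= X)%N]en -addnn leq_add.
apply: eq_bigr => k _; rewrite mulr_suml; apply: eq_big => s.
  by rewrite /Gamma2 [RHS]inE.
move=> /andP[/PRW_stats-/(_ A x x p a)[_ pkd pka en _] /eqP ek].
rewrite -exprD addnBA // addnBAC // -subnDA addnn -mul2n en ek.
by rewrite [p ^+ _ * _]mulrC.
Qed.

(** The value 0 for [vx] kills the words with a double descent; in the others the [k] descents all
    start at peaks and [n - 2k] double ascents remain. *)
Lemma wval_growth_Gamma3 n (A : comNzRingType) (y p a : A) :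
  wval 0 y p 0 a (growth wring ins (va * vy) n) =
    \sum_(0 <= k < n./2.+1) (\sum_(s in Gamma3 n k) a ^+ RLmin s)
      * (p ^+ k * y ^+ (n - 2 * k)).
Proof.
pose noDD (s : 'S_n) := [forall i : 'I_n, ~~ [&& 1 < i, letter s i.-1 > letter s i
                         & letter s i > letter s i.+1]]%N.
rewrite -sum_weight -sum_word rmorph_sum (bigID noDD) /= [X in _ + X]big1 ?addr0; last first.
  move=> s; have [e [d [-> _ _ ns]]] := Gamma3_stats _ s A 0 y p 0 a.
  by rewrite /noDD ns => /negbTE e0; rewrite expr0n e0 !mul0r mulr0.
rewrite (sum_by_value _ _ _ (fun s => des s) n./2); last first.
  move=> s; have [e [d [_ en _ ns]]] := Gamma3_stats _ s A 0 y p 0 a.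
  rewrite /noDD ns => /eqP e0; rewrite [X in (_ <= X./2)%N]en e0 subn0 addn0.
  by rewrite geq_half_double leq_addr.
apply: eq_bigr => k _; rewrite mulr_suml; apply: eq_big => s.
  by rewrite /Gamma3 [RHS]inE andbC.
have [e [d [-> en _ ns]]] := Gamma3_stats _ s A 0 y p 0 a.
rewrite /noDD ns => /andP[/eqP e0 /eqP dk]; rewrite e0 subn0 addn0 dk in en *.
by rewrite expr0 mul1r [in (n - _)%N]en mul2n addKn [p ^+ _ * _]mulrC.
Qed.

(** When the peak mark is an indeterminate, its [k]-th coefficient isolates the sum over [P k]. *)
Lemma coef_growth (I : finType) (P : nat -> pred I) (e : I -> nat) (c : {poly rat}) n k :
  (k <= n./2)%N ->
  (\sum_(0 <= j < n./2.+1) (\sum_(i | P j i) alpha%:P ^+ e i)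
      * ('X^j * c%:P ^+ (n - 2 * j)))`_k =
    (\sum_(i | P k i) alpha ^+ e i) * c ^+ (n - 2 * k).
Proof.
move=> lek; have ltk : (k < n./2.+1)%N by [].
have coefj j : ((\sum_(i | P j i) alpha%:P ^+ e i) * ('X^j * c%:P ^+ (n - 2 * j)))`_k =
    (\sum_(i | P j i) alpha ^+ e i) * ((k == j)%:R * c ^+ (n - 2 * j)).
  rewrite -rmorphXn -coefXn -coefMC -coefCM rmorph_sum /=.
  congr (polyseq (_ * _))`_k; by apply: eq_bigr => i _; rewrite rmorphXn.
rewrite big_mkord coef_sum (bigD1 (Ordinal ltk)) //= coefj eqxx mul1r.
rewrite [X in _ + X]big1 ?addr0 // => j nejk.
by rewrite coefj eq_sym (negbTE (nejk : (nat_of_ord j != k))) mul0r mulr0.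
Qed.

Theorem theorem2p1 (n : nat) (hn : (1 <= n)%N) :
  exists gamma : nat -> {poly rat},
    tildeA n =
      \sum_(0 <= k < n./2.+1) gamma k *: ((x * y) ^+ k * (x + y) ^+ (n - 2 * k))
    /\
    forall k : nat, (k <= n./2)%N ->
      [/\ gamma k = \sum_(s in Gamma1 n k) alpha ^+ (LRmin s + RLmin s - 2),
          \sum_(s in Gamma1 n k) alpha ^+ (LRmin s + RLmin s - 2) =
            ((2%:R : rat) ^ (- n%:Z + 2%:Z * k%:Z)) *:
              \sum_(s in Gamma2 n k) alpha ^+ (LRmin s + RLmin s - 2)
        & ((2%:R : rat) ^ (- n%:Z + 2%:Z * k%:Z)) *:
              \sum_(s in Gamma2 n k) alpha ^+ (LRmin s + RLmin s - 2) =
            \sum_(s in Gamma3 n k) alpha ^+ RLmin s].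
Proof.
exists (fun k => \sum_(s in Gamma1 n k) alpha ^+ (LRmin s + RLmin s - 2)); split.
  pose a : {mpoly {poly rat}[2]} := alpha%:MP.
  (* With [x * y] as peak mark, each peak gives back its descent and its ascent. *)
  have -> : tildeA n = wval x y (x * y) (a * x) a (growth wring ins (vu + va * vy) n).
    rewrite wval_growth_PRW; apply: eq_bigr => s /PRW_stats-/(_ _ x y x a)[_ pkd pka _ _].
    rewrite -mul_mpolyC -rmorphXn exprMn -{1}(subnK pkd) -{1}(subnK pka) !exprD.
    by congr (_ * _); rewrite mulrACA.
  (* Only the sum of the first two marks matters, so [(x, y)] is traded for [(x + y, 0)], where only
     words without double ascents survive. *)
  have -> := growth_wval _ x y (a * x) (x + y) 0 (a * (x + y)) (x * y) a
     (vu + va * vy) (vu + va * vy) n _ ins_start_front ins_start_front.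
  - rewrite wval_growth_Gamma1; apply: eq_bigr => k _.
    rewrite -mul_mpolyC rmorph_sum; congr (_ * _).
    by apply: eq_bigr => s _; rewrite rmorphXn.
  - by rewrite addr0.
  - by rewrite rmorphD rmorphM !wvalE mulrDr.
  - by rewrite rmorphD rmorphM !wvalE mulr0 addr0.
move=> k lek.
(* The marks [(1, 0)], [(1/2, 1/2)] and [(0, 1)] have the same sum 1; the peak mark stays an
   indeterminate. *)
pose h : {poly rat} := (2%:R^-1)%:P.
have h2 : h + h = 1 by rewrite -polyCD -mulr2n -[_ *+ 2]mulr_natr mulVf.
have hP : h%:P + h%:P = 1%:P :> {poly {poly rat}} by rewrite -[RHS](congr1 polyC h2) polyCD.
pose a : {poly {poly rat}} := alpha%:P.
have E12 : wval 1%:P 0 'X (a * 1%:P) a (growth wring ins (vu + va * vy) n) =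
    wval h%:P h%:P 'X (a * h%:P) a (growth wring ins (vu + va * vy) n).
  apply: (growth_wval _ _ _ _ _ _ _ _ _ _ _ _ _ ins_start_front ins_start_front).
  - by rewrite hP addr0.
  - by rewrite rmorphD rmorphM !wvalE mulrDr.
  - by rewrite rmorphD rmorphM !wvalE -mulrDr hP addr0.
(* The start element [va * vy] at [(0, 1)] has the same value [a] as [vu + va * vy] at [(1, 0)]. *)
have E13 : wval 1%:P 0 'X (a * 1%:P) a (growth wring ins (vu + va * vy) n) =
    wval 0 1%:P 'X 0 a (growth wring ins (va * vy) n).
  apply: (growth_wval _ _ _ _ _ _ _ _ _ _ _ _ _ ins_start_front ins_start).
  - by rewrite addrC.
  - by rewrite rmorphD rmorphM !wvalE mulrDr.
  - by rewrite rmorphM !wvalE addr0.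
(* As [2k <= n], the integer exponent is [-(n - 2k)], which matches the power of 1/2 coming from
   [h]. *)
have hk : (2%:R : rat) ^ (- n%:Z + 2%:Z * k%:Z) = 2%:R^-1 ^+ (n - 2 * k).
  have le2k : (2 * k <= n)%N by rewrite mul2n -geq_half_double.
  by rewrite -PoszM addrC -opprB subzn // exprVn exprnN.
have G12 : \sum_(s in Gamma1 n k) alpha ^+ (LRmin s + RLmin s - 2) =
    ((2%:R : rat) ^ (- n%:Z + 2%:Z * k%:Z)) *:
      \sum_(s in Gamma2 n k) alpha ^+ (LRmin s + RLmin s - 2).
  have := congr1 (fun q : {poly {poly rat}} => q`_k) E12.
  rewrite wval_growth_Gamma1 wval_growth_Gamma2 !coef_growth // expr1n mulr1 => ->.
  by rewrite hk -rmorphXn mulrC mul_polyC.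
split=> //; rewrite -G12.
have := congr1 (fun q : {poly {poly rat}} => q`_k) E13.
by rewrite wval_growth_Gamma1 wval_growth_Gamma3 !coef_growth // expr1n !mulr1.
Qed.
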